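(* Let $\nu(y,z;q):=\sum_{n=0}^{\infty} \frac{y^nz^nq^{n^2+n}}{(yq;q^2)_{n+1}}$. Then $$\nu(y,z;q)=\sum_{n=0}^{\infty}(-zq;q^2)_n\,(yq)^n,$$ as an identity of formal power series in $q$ (equivalently, of analytic functions for $|q|<1$ and $y,z$ in a suitable neighbourhood).
   Context: For $n\ge 1$, $(a;q)_0:=1$ and $(a;q)_n:=(1-a)(1-aq)\cdots(1-aq^{n-1})$. Here $y,z$ are indeterminates. *)

(* Defs.v *)
From HB Require Import structures.
From mathcomp Require Import all_boot all_order all_algebra.
From mathcomp Require Import boolp.
From mathcomp Require Export mpoly.

Set Implicit Arguments.
Unset Strict Implicit.
Unset Printing Implicit Defensive.

Import GRing.Theory.

Local Open Scope ring_scope.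

Declare Scope fps_scope.
Delimit Scope fps_scope with fps.

Record fps (A : Type) : Type := Fps { fcoef : nat -> A }.

Section FpsZmod.
Variable A : zmodType.
Implicit Types f g h : fps A.

Lemma fpsP f g : fcoef f =1 fcoef g <-> f = g.
Proof.
split=> [|-> //]; case: f => f; case: g => g /= fg.
by congr Fps; apply/funext.
Qed.

HB.instance Definition _ := gen_eqMixin (fps A).
HB.instance Definition _ := gen_choiceMixin (fps A).

Definition fps_zero : fps A := Fps (fun=> 0).
Definition fps_opp f : fps A := Fps (fun k => - fcoef f k).
Definition fps_add f g : fps A := Fps (fun k => fcoef f k + fcoef g k).

Fact fps_addA : associative fps_add.
Proof. by move=> f g h; apply/fpsP => k /=; rewrite addrA. Qed.
Fact fps_addC : commutative fps_add.
Proof. by move=> f g; apply/fpsP => k /=; rewrite addrC. Qed.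
Fact fps_add0 : left_id fps_zero fps_add.
Proof. by move=> f; apply/fpsP => k /=; rewrite add0r. Qed.
Fact fps_addN : left_inverse fps_zero fps_opp fps_add.
Proof. by move=> f; apply/fpsP => k /=; rewrite addNr. Qed.

HB.instance Definition _ :=
  GRing.isZmodule.Build (fps A) fps_addA fps_addC fps_add0 fps_addN.

End FpsZmod.

Section FpsRing.
Variable A : comNzRingType.
Implicit Types f g h : fps A.

Definition fpsC (a : A) : fps A := Fps (fun k => if k == 0%N then a else 0).

Definition fpsq : fps A := Fps (fun k => (k == 1%N)%:R).

Definition fps_mul f g : fps A :=
  Fps (fun k => \sum_(i < k.+1) fcoef f i * fcoef g (k - i)%N).

Let trunc n f : {poly A} := \poly_(i < n) fcoef f i.

Let coef_trunc n f k : (k < n)%N -> (trunc n f)`_k = fcoef f k.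
Proof. by move=> kn; rewrite coef_poly kn. Qed.

Let coef_trunc_mul n f g k : (k < n)%N ->
  (trunc n f * trunc n g)`_k = fcoef (fps_mul f g) k.
Proof.
move=> kn; rewrite coefM; apply: eq_bigr => i _.
have ik : (i <= k)%N by rewrite -ltnS.
by rewrite !coef_trunc // (leq_ltn_trans _ kn) // leq_subr.
Qed.

Fact fps_mulC : commutative fps_mul.
Proof.
by move=> f g; apply/fpsP => k; rewrite -!(coef_trunc_mul _ _ (ltnSn k)) mulrC.
Qed.

Fact fps_mulA : associative fps_mul.
Proof.
move=> f g h; apply/fpsP => k; set n := k.+1.
have -> : fcoef (fps_mul f (fps_mul g h)) k
        = (trunc n f * (trunc n g * trunc n h))`_k.
  rewrite coefM; apply: eq_bigr => i _.
  by rewrite coef_trunc // coef_trunc_mul // ltnS leq_subr.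
rewrite mulrA coefM; apply: eq_bigr => i _.
by rewrite coef_trunc_mul // coef_trunc // ltnS leq_subr.
Qed.

Fact fps_mul1 : left_id (fpsC 1) fps_mul.
Proof.
move=> f; apply/fpsP => k /=.
rewrite big_ord_recl /= subn0 mul1r big1 ?addr0 // => i _.
by rewrite /= mul0r.
Qed.

Fact fps_mulDl : left_distributive fps_mul (@fps_add A).
Proof.
move=> f g h; apply/fpsP => k /=.
by rewrite -big_split; apply: eq_bigr => i _; rewrite mulrDl.
Qed.

Fact fps_oner_neq0 : fpsC 1 != 0.
Proof.
apply/eqP => /(congr1 (fun f => fcoef f 0)) /= /eqP.
by rewrite oner_eq0.
Qed.

HB.instance Definition _ := GRing.Zmodule_isComNzRing.Build (fps A)
  fps_mulA fps_mulC fps_mul1 fps_mulDl fps_oner_neq0.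

(* The multiplicative inverse in A[[q]] when there is one, and f otherwise. *)
Definition fps_unit : {pred fps A} := fun f => `[< exists g, g * f = 1 >].

Definition fps_inv f : fps A :=
  if pselect (exists g, g * f = 1) is left e then projT1 (cid e) else f.

Fact fps_mulV : {in fps_unit, left_inverse 1 fps_inv *%R}.
Proof.
move=> f /asboolP fU; rewrite /fps_inv.
by case: pselect => // e; case: cid.
Qed.

Fact fps_unitPl f g : g * f = 1 -> fps_unit f.
Proof. by move=> gf1; apply/asboolP; exists g. Qed.

Fact fps_inv_out : {in [predC fps_unit], fps_inv =1 id}.
Proof.
move=> f; rewrite inE /= => /asboolPn fNU; rewrite /fps_inv.
by case: pselect.
Qed.

HB.instance Definition _ := GRing.ComNzRing_hasMulInverse.Build (fps A)
  fps_mulV fps_unitPl fps_inv_out.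

(* Convergence of sum_n F n to s in the q-adic topology: each coefficient of
   the partial sums is eventually equal to that of s. *)
Definition fps_has_sum (F : nat -> fps A) (s : fps A) : Prop :=
  forall k, exists N, forall n, (N <= n)%N ->
    fcoef (\sum_(i < n) F i) k = fcoef s k.

Definition fps_summable (F : nat -> fps A) : Prop := exists s, fps_has_sum F s.

Lemma fps_has_sum_unique F s t : fps_has_sum F s -> fps_has_sum F t -> s = t.
Proof.
move=> Fs Ft; apply/fpsP => k.
have [M FsM] := Fs k; have [N FtN] := Ft k.
by rewrite -(FsM (maxn M N)) ?leq_maxl // FtN ?leq_maxr.
Qed.

(* By convention 0 when the series diverges. *)
Definition fps_sum (F : nat -> fps A) : fps A :=
  if pselect (fps_summable F) is left e then projT1 (cid e) else 0.

Lemma fps_sumP F : fps_summable F -> fps_has_sum F (fps_sum F).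
Proof. by move=> FS; rewrite /fps_sum; case: pselect => // e; case: cid. Qed.

Lemma fps_sumE F s : fps_has_sum F s -> fps_sum F = s.
Proof.
by move=> Fs; apply: fps_has_sum_unique (fps_sumP _) (Fs); exists s.
Qed.

End FpsRing.

Arguments fpsq {A}.

Notation "c %:S" := (fpsC c) (at level 1, format "c %:S") : fps_scope.
Notation "''q'" := (@fpsq _) (at level 0) : fps_scope.

Local Open Scope fps_scope.

Definition qpochhammer (B : pzRingType) (a p : B) (n : nat) : B :=
  \prod_(i < n) (1 - a * p ^+ i).

Definition nu_term (A : comNzRingType) (y z : A) (n : nat) : fps A :=
  y%:S ^+ n * z%:S ^+ n * 'q ^+ (n ^ 2 + n)
    / qpochhammer (y%:S * 'q) ('q ^+ 2) n.+1.

Definition nu (A : comNzRingType) (y z : A) : fps A := fps_sum (nu_term y z).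

Section DenominatorUnits.
Variable A : comNzRingType.
Implicit Types f g h : fps A.

Lemma fcoef_qM f k : fcoef ('q * f) k = if k is k'.+1 then fcoef f k' else 0.
Proof.
have -> : fcoef ('q * f) k
  = \sum_(i < k.+1) (i == 1%N :> nat)%:R * fcoef f (k - i)%N.
  by [].
case: k => [|k]; first by rewrite big_ord_recl big_ord0 mul0r addr0.
rewrite big_ord_recl /= mul0r add0r big_ord_recl /= mul1r subSS subn0.
by rewrite big1 ?addr0 // => i _; rewrite /= mul0r.
Qed.

Lemma fcoef_qXM f n k : (k < n)%N -> fcoef ('q ^+ n * f) k = 0.
Proof.
elim: n k => // n IHn [|k] kn; rewrite exprS -mulrA fcoef_qM //.
exact: IHn.
Qed.

Lemma fcoef_sum (I : Type) (r : seq I) (P : pred I) (F : I -> fps A) k :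
  fcoef (\sum_(i <- r | P i) F i) k = \sum_(i <- r | P i) fcoef (F i) k.
Proof. exact: (big_morph (fun f => fcoef f k)). Qed.

Lemma fps_unit_1subqM f : 1 - 'q * f \is a GRing.unit.
Proof.
set h := 'q * f.
have hX n k : (k < n)%N -> fcoef (h ^+ n) k = 0.
  by move=> kn; rewrite exprMn fcoef_qXM.
pose S n := \sum_(i < n) h ^+ i.
have Sstable k n : (k < n)%N -> fcoef (S n) k = fcoef (S k.+1) k.
  move=> kn; rewrite !fcoef_sum -(subnKC kn) big_split_ord /=.
  by rewrite [X in _ + X]big1 ?addr0 // => i _; rewrite hX // leq_addr.
pose g : fps A := Fps (fun k => fcoef (S k.+1) k).
suff gh1 : g * (1 - h) = 1 by apply/asboolP; exists g.
apply/fpsP => k.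
have -> : fcoef (g * (1 - h)) k = fcoef (S k.+1 * (1 - h)) k.
  apply: eq_bigr => i _; congr (_ * _).
  by rewrite [RHS]Sstable.
by rewrite mulrC -opprB mulNr -subrX1 opprB /= hX // subr0.
Qed.

Lemma qpochhammer_unit (y : A) n :
  qpochhammer (y%:S * 'q) ('q ^+ 2) n \is a GRing.unit.
Proof.
apply: rpred_prod => i _; rewrite [y%:S * _]mulrC -mulrA.
exact: fps_unit_1subqM.
Qed.

End DenominatorUnits.

(* Main.v *)
Require Import Defs.
From mathcomp Require Import all_boot all_order all_algebra.
From mathcomp Require Import mpoly.
From mathcomp Require Import ring.

(** Put F_m = sum_n (-zq;q^2)_n (y q^(2m+1))^n, so that F_0 is the right-hand
    side.  Splitting off the term n = 0 and writing
    (-zq;q^2)_(n+1) = (-zq;q^2)_n (1 + z q^(2n+1)) yields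
    (1 - y q^(2m+1)) F_m = 1 + y z q^(2m+2) F_(m+1).
    Iterating N times expresses F_0 as the N-th partial sum of nu plus
    (yz)^N q^(N^2+N) F_N / (yq;q^2)_N, which tends to 0 q-adically. *)

Set Implicit Arguments.
Unset Strict Implicit.
Unset Printing Implicit Defensive.

Import GRing.Theory.

Local Open Scope ring_scope.
Local Open Scope fps_scope.

Section QAdicSums.
Variable A : comNzRingType.
Implicit Types (f g s t c : fps A) (F G : nat -> fps A).

(* An algebraic form of convergence, with speed: the N-th remainder lies in the
   ideal (q^N).  Unlike [fps_has_sum], it is visibly compatible with products. *)
Definition qadic_sum F s : Prop :=
  forall N, exists r, s = \sum_(i < N) F i + 'q ^+ N * r.

Lemma qadic_sum_has_sum F s : qadic_sum F s -> fps_has_sum F s.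
Proof.
move=> Fs k; exists k.+1 => n kn; have [r ->] := Fs n.
by rewrite -[RHS]/(fcoef _ k + fcoef ('q ^+ n * r) k) fcoef_qXM // addr0.
Qed.

Lemma qadic_sum_unique F s t : qadic_sum F s -> qadic_sum F t -> s = t.
Proof.
by move=> /qadic_sum_has_sum Fs /qadic_sum_has_sum; apply: fps_has_sum_unique.
Qed.

Lemma qadic_sumD F G s t :
  qadic_sum F s -> qadic_sum G t -> qadic_sum (fun n => F n + G n) (s + t).
Proof.
move=> Fs Gt N; have [r ->] := Fs N; have [r' ->] := Gt N.
by exists (r + r'); rewrite big_split mulrDr addrACA.
Qed.

Lemma qadic_sumZ c F s : qadic_sum F s -> qadic_sum (fun n => c * F n) (c * s).
Proof.
move=> Fs N; have [r ->] := Fs N.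
by exists (c * r); rewrite mulrDr mulr_sumr mulrCA.
Qed.

Lemma qadic_sum_behead F s :
  qadic_sum F s -> qadic_sum (fun n => F n.+1) (s - F 0%N).
Proof.
move=> Fs N; have [r ->] := Fs N.+1.
exists ('q * r).
by rewrite big_ord_recl addrAC (addrAC (F 0)) subrr add0r exprSr mulrA.
Qed.

(** The sum of all ['q ^+ i * g i]: terms with [i > k] do not reach the coefficient of index [k], so
    the finite cut is exact. *)
Definition qseries (g : nat -> fps A) : fps A :=
  Fps (fun k => \sum_(i < k.+1) fcoef ('q ^+ i * g i) k).

Lemma qseries_recl (g : nat -> fps A) :
  qseries g = g 0%N + 'q * qseries (fun n => g n.+1).
Proof.
apply/fpsP => k; rewrite -[LHS]/(\sum_(i < k.+1) fcoef ('q ^+ i * g i) k).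
rewrite big_ord_recl expr0 mul1r.
rewrite -[RHS]/(_ + fcoef ('q * _) k) fcoef_qM; congr (_ + _).
case: k => [|k]; first by rewrite big_ord0.
by apply: eq_bigr => i _; rewrite exprS -mulrA fcoef_qM.
Qed.

Lemma qseries_sum (g : nat -> fps A) :
  qadic_sum (fun n => 'q ^+ n * g n) (qseries g).
Proof.
(* The remainder is the series of the shifted [g]; each induction step peels off its head. *)
move=> N; exists (qseries (fun n => g (N + n)%N)).
elim: N => [|N IHN]; first by rewrite big_ord0 add0r expr0 mul1r.
rewrite IHN qseries_recl addn0 big_ord_recr /= mulrDr addrA exprSr -mulrA.
by congr (_ + _ * (_ * qseries _)); apply/boolp.funext => n; rewrite addnS.
Qed.

End QAdicSums.

Lemma qpochhammerS (B : pzRingType) (a p : B) n :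
  qpochhammer a p n.+1 = qpochhammer a p n * (1 - a * p ^+ n).
Proof. exact: big_ord_recr. Qed.

Section NuIdentity.
Variables (A : comNzRingType) (y z : A).

Let P n : fps A := qpochhammer (- z%:S * 'q) ('q ^+ 2) n.
Let D n : fps A := qpochhammer (y%:S * 'q) ('q ^+ 2) n.

(** The ratio y q^(2m+1) is [w m * 'q]; keeping one ['q] apart supplies the powers ['q ^+ n] that
    [qseries] needs. *)
Let w m : fps A := y%:S * 'q ^+ (2 * m).
Let F m : fps A := qseries (fun n => P n * w m ^+ n).

Let F_sum m : qadic_sum (fun n => P n * (w m * 'q) ^+ n) (F m).
Proof.
have -> : (fun n => P n * (w m * 'q) ^+ n)
        = (fun n => 'q ^+ n * (P n * w m ^+ n)).
  by apply/boolp.funext => n; rewrite exprMn; ring.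
exact: qseries_sum.
Qed.

(** In the last factor 1 + z q^(2n+1), the power q^(2n) is absorbed by turning [w m ^+ n] into
    [w m.+1 ^+ n]. *)
Let P_recl m n : P n.+1 * (w m * 'q) ^+ n.+1
  = w m * 'q * (P n * (w m * 'q) ^+ n + z%:S * 'q * (P n * (w m.+1 * 'q) ^+ n)).
Proof.
have -> : w m.+1 = w m * 'q ^+ 2 by rewrite /w mulnS addnC exprD mulrA.
rewrite /P qpochhammerS; move: (w m) (qpochhammer _ _ n) => W Q.
by rewrite !exprMn !exprS; ring.
Qed.

Let F_rec m : (1 - w m * 'q) * F m = 1 + w m * z%:S * 'q ^+ 2 * F m.+1.
Proof.
have term0 : 1 = P 0 * (w m * 'q) ^+ 0.
  by rewrite expr0 mulr1 /P /qpochhammer big_ord0.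
have tail : qadic_sum (fun n => P n.+1 * (w m * 'q) ^+ n.+1) (F m - 1).
  by rewrite term0; exact: qadic_sum_behead (F_sum m).
have := qadic_sumZ (w m * 'q)
  (qadic_sumD (F_sum m) (qadic_sumZ (z%:S * 'q) (F_sum m.+1))).
(* Two sums of the same tail series: [F m - 1] and the combination of [F m] and [F m.+1]. *)
rewrite -(boolp.funext (P_recl m)) => /(qadic_sum_unique tail) F_split.
rewrite mulrBl mul1r -[X in X - _](subrK 1) F_split.
by ring.
Qed.

Let nu_iter N : F 0 = \sum_(i < N) nu_term y z i
  + y%:S ^+ N * z%:S ^+ N * 'q ^+ (N ^ 2 + N) / D N * F N.
Proof.
elim: N => [|N IHN].
  by rewrite big_ord0 /D /qpochhammer big_ord0 !expr0 invr1 !mul1r add0r.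
rewrite {}IHN big_ord_recr /= -addrA; congr (_ + _).
have DS : D N.+1 = D N * (1 - w N * 'q).
  by rewrite /D qpochhammerS /w -exprM mulrAC.
(* This exposes the factor on which [F_rec] acts. *)
have DV : (D N)^-1 = (1 - w N * 'q) / D N.+1.
  apply: (mulrI (qpochhammer_unit y N)).
  by rewrite divrr ?mulrA -?DS ?divrr ?qpochhammer_unit.
rewrite DV mulrA mulrAC -(mulrA _ (1 - _)) F_rec.
(* The increment splits as [2 * N] from [w N] and 2 from [F_rec]. *)
have -> : (N.+1 ^ 2 + N.+1 = N ^ 2 + N + 2 * N + 2)%N by rewrite -addn1; ring.
rewrite /nu_term -/(D N.+1) /w (exprD _ (_ + _) 2) (exprD _ _ (2 * N)).
rewrite (exprSr y%:S) (exprSr z%:S).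
move: (_ ^+ (2 * N)) (_ ^-1) (F N.+1) => W V G.
by ring.
Qed.

Lemma qadic_sum_nu : qadic_sum (nu_term y z) (F 0).
Proof.
(* One factor ['q ^+ N] suffices for the remainder bound; ['q ^+ (N ^ 2)] goes into the witness. *)
move=> N; rewrite (nu_iter N) (_ : (N ^ 2 + N = N + N ^ 2)%N) 1?addnC // exprD.
exists (y%:S ^+ N * z%:S ^+ N * 'q ^+ (N ^ 2) / D N * F N).
by congr (_ + _); ring.
Qed.

Lemma qadic_sum_pochhammer : qadic_sum (fun n => P n * (y%:S * 'q) ^+ n) (F 0).
Proof. by have := F_sum 0; rewrite /w expr0 mulr1. Qed.

End NuIdentity.

Theorem theorem3 (R : comNzRingType) :
  let y : {mpoly R[2]} := 'X_ord0 in
  let z : {mpoly R[2]} := 'X_ord_max in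
  let rhs_term (n : nat) : fps {mpoly R[2]} :=
    qpochhammer (- z%:S * 'q) ('q ^+ 2) n * (y%:S * 'q) ^+ n in
  [/\ fps_summable (nu_term y z),
      fps_summable rhs_term
    & nu y z = fps_sum rhs_term].
Proof.
move=> y z rhs_term.
have nu_sum := qadic_sum_has_sum (qadic_sum_nu y z).
have rhs_sum := qadic_sum_has_sum (qadic_sum_pochhammer y z).
split; [by eexists; exact: nu_sum | by eexists; exact: rhs_sum |].
by rewrite /nu (fps_sumE nu_sum) (fps_sumE rhs_sum).
Qed.
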